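(* Let $\{c_n\}_{n\ge1}$ be a real sequence with $\sum_{n=1}^\infty |c_n|<+\infty$, such that $\sum_{n=N}^{\infty}(c_n)^2>0$ and $\sum_{n=N}^\infty c_n\neq 0$ for every $N\ge1$. Let $f(x):=\sum_{n=1}^\infty c_n\varphi^{(n)}(x)$ and $f_N(x):=\sum_{n=1}^{N-1}c_n\varphi^{(n)}(x)$ for $x\in[0,1]$. If for every $K>0$ $$\sum_{N=1}^\infty\exp\left\{-K\cdot\frac{\left(\sum_{n=N}^\infty c_n\right)^2}{\sum_{n=N}^\infty (c_n)^2}\right\}<+\infty,$$ then $$\lim_{N\to\infty}\frac{f(x)-f_N(x)}{\frac12\sum_{n=N}^\infty c_n}=1\quad\text{for Lebesgue-a.e. } x\in[0,1].$$
   Context: The tent map on $[0,1]$ is $\varphi(x)=2x$ for $x\in[0,1/2]$ and $\varphi(x)=2(1-x)$ for $x\in[1/2,1]$; it is extended to $\mathbb{R}$ by $\varphi(x):=\varphi(x-[x])$, and $\varphi^{(n)}$ denotes the $n$-fold iterate of $\varphi$, so that $\varphi^{(n)}(x)=\varphi(2^{n-1}x)$. *)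

(* Defs.v *)
From HB Require Import structures.
From mathcomp Require Import all_boot all_order all_algebra.
From mathcomp Require Import all_classical all_reals all_analysis.
Set Implicit Arguments. Unset Strict Implicit. Unset Printing Implicit Defensive.
Import Order.TTheory GRing.Theory Num.Theory.
Local Open Scope ring_scope.

Definition tent {R : realType} (x : R) : R :=
  let y := x - (Num.floor x)%:~R in
  if y <= 2^-1 then 2 * y else 2 * (1 - y).

Definition tent_iter {R : realType} (n : nat) (x : R) : R := iter n tent x.

Definition tailsum {R : realType} (u : nat -> R) (N : nat) : R :=
  limn (fun M => \sum_(N <= n < M) u n).

Definition tent_f {R : realType} (c : nat -> R) (x : R) : R :=
  tailsum (fun n => c n * tent_iter n x) 1.

Definition tent_fN {R : realType} (c : nat -> R) (N : nat) (x : R) : R :=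
  \sum_(1 <= n < N) c n * tent_iter n x.

(* Main.v *)
Require Import Defs.
From HB Require Import structures.
From mathcomp Require Import all_boot all_order all_algebra.
From mathcomp Require Import all_classical all_reals all_analysis.
From mathcomp Require Import measurable_realfun ring lra.
Set Implicit Arguments. Unset Strict Implicit. Unset Printing Implicit Defensive.
Import Order.TTheory GRing.Theory Num.Theory.
Import numFieldNormedType.Exports.
Local Open Scope ring_scope.
Local Open Scope classical_set_scope.

(** With [s_N] and [v_N] the tail sums of [c_n] and [c_n^2], the quotient minus 1
    is [2 D_N / s_N], where [D_N] is the sum over [n >= N] of
    [c_n (phi^(n) - 1/2)].  Given [phi(x) = y], the point [x] is [y/2] or
    [1 - y/2] with equal probability, so the functions [phi^(n) - 1/2] are
    bounded reverse martingale differences for Lebesgue measure on [[0, 1]].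
    Hence, as in the Azuma-Hoeffding inequality, the integral of
    [exp(l D_N)] is at most [exp(l^2 v_N / 2)], and the event [|D_N| > k |s_N|]
    has measure at most [2 exp(- k^2 s_N^2 / (2 v_N))], which is summable; the
    Borel-Cantelli lemma concludes. *)

(** * A Gaussian bound on the hyperbolic cosine *)

(** The sharp exponent is [x^2 / 2]; the cruder one only changes the Gaussian rate, and summability
    is assumed for every rate [K > 0]. *)
Lemma expR_sym_le (R : realType) (x : R) :
  expR x + expR (- x) <= 2 * expR (2 * x ^+ 2).
Proof.
(* For small [x], [exp(x) <= 1 / (1 - x)] and its mirror image add up to
   [2 / (1 - x^2)]; for large [x], [|x| <= 2 x^2]. *)
have [x2|x2] := leP (x ^+ 2) 2^-1.
  have x1 : -1 < x < 1 by nra.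
  have bound (y : R) : y < 1 -> expR y <= (1 - y)^-1.
    move=> y1; rewrite -[y in expR y]opprK expRN lef_pV2 ?posrE ?expR_gt0 ?subr_gt0//.
    exact: expR_ge1Dx.
  have bx : expR x <= (1 - x)^-1 by apply: bound; lra.
  have bNx : expR (- x) <= (1 - - x)^-1 by apply: bound; lra.
  apply: (le_trans (lerD bx bNx)).
  have -> : (1 - x)^-1 + (1 - - x)^-1 = 2 * (1 - x ^+ 2)^-1.
    by field; rewrite !gt_eqF//=; nra.
  rewrite ler_pM2l//; apply: (@le_trans _ _ (1 + 2 * x ^+ 2)); last exact: expR_ge1Dx.
  by rewrite -div1r ler_pdivrMr; nra.
have x1 : `|x| <= 2 * x ^+ 2.
  by have := normr_ge0 x; move: x2; rewrite -(real_normK (num_real x)); nra.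
rewrite mulrDl !mul1r; apply: lerD; rewrite ler_expR.
  exact: le_trans (ler_norm _) x1.
by rewrite -normrN in x1; exact: le_trans (ler_norm _) x1.
Qed.

(** * The tent map on the unit interval and its two inverse branches *)

(* On [[0, 1]] this is [tent], and unlike the formula with the floor it is
   visibly continuous. *)
Definition fold {R : realType} (x : R) : R := 1 - `|1 - 2 * x|.

Lemma fold_itv {R : realType} (x : R) : `[0, 1] x -> `[0, 1] (fold x).
Proof.
rewrite /= !in_itv/= /fold => /andP[x0 x1].
by have := normr_ge0 (1 - 2 * x); have : `|1 - 2 * x| <= 1; [rewrite ler_norml|]; lra.
Qed.

Lemma tent_fold {R : realType} (x : R) : `[0, 1] x -> tent x = fold x.
Proof.
rewrite /= in_itv/= => /andP[x0]; rewrite le_eqVlt => /predU1P[->|x1].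
  (* At [x = 1] the fractional part jumps back to 0, yet both sides equal 0. *)
  rewrite /tent floor1 subrr /fold ifT ?invr_ge0//.
  by rewrite ler0_norm; lra.
rewrite /tent (_ : Num.floor x = 0) ?subr0; last by apply/eqP; rewrite floor_eq x0.
rewrite /fold; case: ifP => [h|/negbT]; first by rewrite ger0_norm; lra.
by rewrite -ltNge => h; rewrite ltr0_norm; lra.
Qed.

Lemma iter_fold_itv {R : realType} n (x : R) : `[0, 1] x -> `[0, 1] (iter n fold x).
Proof. by move=> x01; elim: n => //= n; exact: fold_itv. Qed.

Lemma tent_iter_fold {R : realType} n (x : R) :
  `[0, 1] x -> tent_iter n x = iter n fold x.
Proof.
move=> x01; elim: n => // n IH; rewrite /tent_iter /= -/(tent_iter n x) IH.
exact/tent_fold/iter_fold_itv.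
Qed.

Lemma continuous_fold {R : realType} : continuous (@fold R).
Proof.
move=> x; apply: cvgB; first exact: cvg_cst.
apply: cvg_norm; apply: cvgB; first exact: cvg_cst.
by apply: cvgM; [exact: cvg_cst|exact: cvg_id].
Qed.

Lemma continuous_iter_fold {R : realType} n : continuous (iter n (@fold R)).
Proof.
elim: n => [|n IH] x; first exact: cvg_id.
exact: (continuous_comp (IH x) (@continuous_fold R _)).
Qed.

(** With the next lemma, this gives the two preimages of [y]; [y <= 1] fixes the sign under the
    absolute value. *)
Lemma fold_half {R : realType} (y : R) : y <= 1 -> fold (2^-1 * y) = y.
Proof. by move=> y1; rewrite /fold ger0_norm; lra. Qed.

Lemma fold_onem_half {R : realType} (y : R) : y <= 1 -> fold (1 - 2^-1 * y) = y.
Proof. by move=> y1; rewrite /fold ler0_norm; lra. Qed.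

(** * Averaging over preimages, and exponential moments *)

Section integral_fold.
Context {R : realType}.
Notation mu := (@lebesgue_measure R).

Let integral_half (G : R -> R) : continuous G ->
  (\int[mu]_(x in `[0%R, 2^-1%R]) (G x)%:E =
   \int[mu]_(x in `[0%R, 1%R]) (2^-1 * G (2^-1 * x))%:E)%E.
Proof.
move=> cG; have dF : (fun x : R => 2^-1 * x)^`() = cst 2^-1.
  by apply/funext => z; rewrite derive1Ml// derive1_id mulr1.
have := @integration_by_substitution_increasing R (fun x => 2^-1 * x) G 0 1 ler01.
rewrite mulr0 mulr1 => ->//; last 6 first.
- by move=> x y _ _ xy /=; rewrite ltr_pM2l// invr_gt0.
- by rewrite dF => z _; exact: cvg_cst.
- by rewrite dF; exact: is_cvg_cst.
- by rewrite dF; exact: is_cvg_cst.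
- split => //.
  + by apply: cvg_at_right_filter; apply: cvgM => //; exact: cvg_cst.
  + by apply: cvg_at_left_filter; apply: cvgM => //; exact: cvg_cst.
- exact: continuous_subspaceT.
by rewrite dF; apply: eq_integral => x _; rewrite fctE /= mulrC.
Qed.

Let continuousT_comp (F G : R -> R) :
  continuous F -> continuous G -> continuous (fun x : R => G (F x)).
Proof. by move=> cF cG x; exact: (continuous_comp (cF x) (cG _)). Qed.

Let continuousMl (k : R) (F : R -> R) :
  continuous F -> continuous (fun x : R => k * F x).
Proof. by move=> cF x; apply: cvgM; [exact: cvg_cst|exact: cF]. Qed.

Let continuous_half : continuous (fun x : R => 2^-1 * x).
Proof. by apply: continuousMl => x; exact: cvg_id. Qed.

Let mE (F : R -> R) (D : set (measurableTypeR R)) :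
  measurable D -> continuous F ->
  measurable_fun D (fun x : measurableTypeR R => (F x)%:E).
Proof.
move=> mD cF; apply/measurable_EFinP.
by apply: measurable_funTS; exact: continuous_measurable_fun.
Qed.

(** This is conditioning on the image under [fold]: cut at 1/2, reflect the right half onto the left
    one, and stretch both by 2. Nonnegativity lets the integrals be added without integrability. *)
Lemma integral_itv01_fold (G : R -> R) : continuous G -> (forall x, 0 <= G x) ->
  (\int[mu]_(x in `[0%R, 1%R]) (G x)%:E =
   \int[mu]_(x in `[0%R, 1%R])
     (2^-1 * (G (2^-1 * x) + G (1 - 2^-1 * x)))%:E)%E.
Proof.
move=> cG G0.
have cGo : continuous (fun x : R => G (1 - x)).
  apply: continuousT_comp => // x.
  by apply: cvgB; [exact: cvg_cst|exact: cvg_id].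
(* The left piece is half-open to make the pieces disjoint; its endpoint, a null set, is restored
   below. *)
rewrite [in LHS](@itv_bndbnd_setU _ _ _ (BLeft (2^-1))) ?bnd_simp
  ?invr_ge0// ?invf_le1 ?ler1n//.
rewrite ge0_integral_setU//=; last 3 first.
- by apply: mE => //; exact: measurableU.
- by move=> x _; rewrite lee_fin.
- by apply/disj_setPS => x [/=]; rewrite !in_itv/= => /andP[_ ?] /andP[? _]; lra.
rewrite integral_itv_bndo_bndc; last exact: mE.
have -> : (\int[mu]_(x in `[2^-1%R, 1%R]) (G x)%:E =
    \int[mu]_(x in `[0%R, 2^-1%R]) (G (1 - x))%:E)%E.
  rewrite (@integration_by_substitution_onem _ (fun x => G (1 - x))); last 2 first.
  - by lra.
  - exact: continuous_subspaceT.
  rewrite /unstable.onem (_ : 1 - 2^-1 = 2^-1); last lra.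
  by apply: eq_integral => x _; rewrite opprB addrCA subrr addr0.
have c1 : continuous (fun x : R => 2^-1 * G (2^-1 * x)).
  by apply: continuousMl; exact: (continuousT_comp continuous_half cG).
have c2 : continuous (fun x : R => 2^-1 * G (1 - 2^-1 * x)).
  by apply: continuousMl; exact: (continuousT_comp continuous_half cGo).
rewrite !integral_half// -ge0_integralD//=.
- by apply: eq_integral => x _; rewrite mulrDr EFinD.
- by move=> x _; rewrite lee_fin mulr_ge0// invr_ge0.
- exact: (mE _ c1).
- by move=> x _; rewrite lee_fin mulr_ge0// invr_ge0.
- exact: (mE _ c2).
Qed.

(** Induction on [m] with [a] general. All terms but the first depend on [x] only through [fold x],
    so averaging over the two preimages affects the first term alone and turns its exponential into
    a hyperbolic cosine. *)
Lemma integral_expR_iter_fold (m : nat) (a : nat -> R) :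
  (\int[mu]_(x in `[0%R, 1%R])
     (expR (\sum_(0 <= i < m) a i * (iter i fold x - 2^-1)))%:E
   <= (expR (2^-1 * \sum_(0 <= i < m) a i ^+ 2))%:E)%E.
Proof.
elim: m a => [|m IH] a.
  rewrite !big_geq// mulr0 expR0.
  under eq_integral do rewrite big_geq// expR0.
  rewrite (integral_cst _ _ 1%E)// mul1e.
  by rewrite /= lebesgue_measure_itv/= lte_fin ltr01 oppr0 adde0.
pose F (b : nat -> R) k x := \sum_(0 <= i < k) b i * (iter i fold x - 2^-1).
have cF b k : continuous (F b k).
  rewrite /F; elim: k => [|k IHk].
    by under eq_fun do rewrite big_geq//; exact: cst_continuous.
  under eq_fun do rewrite big_nat_recr//=.
  move=> x; apply: cvgD; first exact: IHk.
  apply: cvgM; first exact: cvg_cst.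
  by apply: cvgB; [exact: continuous_iter_fold|exact: cvg_cst].
have ceF b k : continuous (fun x => expR (F b k x)).
  by apply: continuousT_comp => //; exact: continuous_expR.
have FS x : F a m.+1 x = a 0%N * (x - 2^-1) + F (a \o S) m (fold x).
  rewrite /F big_nat_recl//=; congr (_ + _).
  by apply: eq_bigr => i _; rewrite -iterSr.
rewrite integral_itv01_fold; [|exact: (ceF a m.+1)|by move=> x; rewrite expR_ge0].
rewrite big_nat_recl// mulrDr expRD EFinM.
apply: (@le_trans _ _ (\int[mu]_(x in `[0%R, 1%R])
  ((expR (2^-1 * a 0%N ^+ 2))%:E * (expR (F (a \o S) m x))%:E))%E); last first.
  rewrite ge0_integralZl_EFin ?expR_ge0//; last first.
    exact: (mE _ (ceF (a \o S) m)).
  by apply: lee_wpmul2l; [rewrite lee_fin expR_ge0|exact: IH].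
have conem : continuous (fun x : R => 1 - 2^-1 * x).
  by move=> x; apply: cvgB; [exact: cvg_cst|exact: continuous_half].
have c1 : continuous (fun x : R =>
    2^-1 * (expR (F a m.+1 (2^-1 * x)) + expR (F a m.+1 (1 - 2^-1 * x)))).
  apply: continuousMl => x.
  apply: cvgD; first exact: (continuousT_comp continuous_half (ceF a m.+1)).
  exact: (continuousT_comp conem (ceF a m.+1)).
have c2 : continuous (fun x : R => expR (2^-1 * a 0%N ^+ 2) * expR (F (a \o S) m x)).
  exact: continuousMl.
apply: ge0_le_integral => //=.
- exact: (mE _ c1).
- exact: (mE _ c2).
move=> x; rewrite in_itv/= => /andP[x0 x1].
rewrite -!/(F a m.+1 _) !FS fold_half// fold_onem_half// -EFinM lee_fin.
rewrite !expRD -mulrDl mulrA ler_wpM2r ?expR_ge0//.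
(* The two preimages are symmetric about 1/2, so the first terms are [y] and [- y]; as [|y|] is at
   most [|a 0| / 2], [2 y^2] is at most [(a 0)^2 / 2]. *)
set y := a 0%N * (2^-1 * x - 2^-1).
have -> : a 0%N * (1 - 2^-1 * x - 2^-1) = - y by rewrite /y; lra.
rewrite ler_pdivrMl//; apply: (le_trans (expR_sym_le _)).
rewrite ler_pM2l// ler_expR /y exprMn mulrCA [leRHS]mulrC ler_wpM2l ?sqr_ge0//.
nra.
Qed.

End integral_fold.

(** * Convergence and comparison of tail sums *)

Section tail_sums.
Context {R : realType}.
Implicit Types u v c : R^nat.

Let cvgn_sum_sub u N : cvgn (series u) ->
  (fun M => \sum_(N <= n < M) u n) @ \oo --> limn (series u) - series u N.
Proof.
move=> cu.
have : (fun M => series u M - series u N) @ \oo --> limn (series u) - series u N.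
  by apply: cvgB => //; exact: cvg_cst.
apply: cvg_trans; apply: near_eq_cvg; near=> M.
by rewrite sub_series_geq//; near: M; exact: nbhs_infty_ge.
Unshelve. all: end_near. Qed.

Lemma tailsumE u N : cvgn (series u) ->
  tailsum u N = limn (series u) - series u N.
Proof. by move=> cu; apply: cvg_lim => //; exact: cvgn_sum_sub. Qed.

Lemma cvgn_tailsum u N : cvgn (series u) ->
  (fun M => \sum_(N <= n < M) u n) @ \oo --> tailsum u N.
Proof. by move=> cu; rewrite tailsumE//; exact: cvgn_sum_sub. Qed.

Lemma tailsum_split u N M : (N <= M)%N -> cvgn (series u) ->
  tailsum u N = \sum_(N <= n < M) u n + tailsum u M.
Proof.
move=> NM cu; rewrite !tailsumE// -sub_series_geq//.
by rewrite [RHS]addrC addrA subrK.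
Qed.

Lemma tailsum_lin k u v N : cvgn (series u) -> cvgn (series v) ->
  tailsum (fun n => u n + k * v n) N = tailsum u N + k * tailsum v N.
Proof.
move=> cu cv; apply: cvg_lim => //; under eq_fun do rewrite big_split -mulr_sumr /=.
apply: cvgD; first exact: cvgn_tailsum.
by apply: cvgM; [exact: cvg_cst|exact: cvgn_tailsum].
Qed.

Lemma tailsum_cvg0 u : cvgn (series u) -> tailsum u @ \oo --> (0 : R).
Proof.
move=> cu; rewrite (_ : tailsum u = fun N => limn (series u) - series u N).
  by rewrite -(subrr (limn (series u))); apply: cvgB => //; exact: cvg_cst.
by apply/funext => N; rewrite tailsumE.
Qed.

Lemma sum_le_tailsum u N M : cvgn (series u) -> (forall n, 0 <= u n) ->
  \sum_(N <= n < M) u n <= tailsum u N.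
Proof.
move=> cu u0; apply: nondecreasing_cvgn_le => [a b ab|]; last first.
  by apply/cvg_ex; exists (tailsum u N); exact: cvgn_tailsum.
have [Na|aN] := leqP N a; last by rewrite big_geq 1?ltnW// sumr_ge0.
by rewrite (@big_cat_nat _ _ _ a N b)//= lerDl sumr_ge0.
Qed.

Lemma dominated_cvgn_series u c : cvgn [normed series c] ->
  (forall n, `|u n| <= `|c n|) -> cvgn (series u).
Proof. by move=> cc uc; apply: normed_cvg; exact: (series_le_cvg _ _ uc). Qed.

Lemma ler_norm_tailsum u c N : cvgn [normed series c] ->
  (forall n, `|u n| <= `|c n|) -> `|tailsum u N| <= tailsum (fun n => `|c n|) N.
Proof.
move=> cc uc; have cu := dominated_cvgn_series cc uc.
have cn := @cvgn_tailsum _ N cc.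
apply: (ler_cvg_to (cvg_norm (@cvgn_tailsum _ N cu)) cn); apply: nearW => M /=.
by apply: (le_trans (ler_norm_sum _ _ _)); exact: ler_sum.
Qed.

(** Each [|c n|] is at most the sum [L] of the absolute series, so [L * c n] dominates the
    square. *)
Lemma cvgn_series_sqr c : cvgn [normed series c] -> cvgn (series (fun n => c n ^+ 2)).
Proof.
move=> cc; apply: (@dominated_cvgn_series _ (fun n => limn [normed series c] * c n)).
  rewrite (_ : [normed series _] = series (limn [normed series c] *: (fun n => `|c n|))).
    exact: is_cvg_seriesZ.
  have L0 : 0 <= limn [normed series c].
    by apply: limr_ge => //; apply: nearW => n; rewrite /series/= sumr_ge0.
  by congr series; apply/funext => n; rewrite /= normrM (ger0_norm L0).
move=> n; rewrite normrX normrM expr2 ler_wpM2r//; apply: (le_trans _ (ler_norm _)).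
apply: (@le_trans _ _ ([normed series c] n.+1)).
  by rewrite -[leRHS]/(series (fun k => `|c k|) n.+1) seriesSr lerDr /series/= sumr_ge0.
apply: nondecreasing_cvgn_le => //.
by apply: nondecreasing_series => k _ _; exact: normr_ge0.
Qed.

Lemma cvgn_normed_series c : (\sum_(1 <= n <oo) (`|c n|)%:E < +oo)%E ->
  cvgn [normed series c].
Proof.
move=> coo; apply: nondecreasing_is_cvgn.
  by apply: nondecreasing_series => k _ _; exact: normr_ge0.
(* The hypothesis starts at index 1 but [series] at 0, so the term [c 0] enters the bound
   separately. *)
exists (`|c 0%N| + fine (\sum_(1 <= n <oo) (`|c n|)%:E)%E) => _ [n _ <-].
apply: (@le_trans _ _ ([normed series c] n.+1)).
  by apply: nondecreasing_series => // k _ _; exact: normr_ge0.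
rewrite -[leLHS]/(\sum_(0 <= k < n.+1) `|c k|) big_ltn// lerD2l -lee_fin fineK.
  rewrite -sumEFin; exact: nneseries_lim_ge.
by rewrite ge0_fin_numE//; apply: nneseries_ge0.
Qed.

End tail_sums.

(** * Borel-Cantelli, and exponential moments of finite blocks *)

Section almost_everywhere_bounds.
Context {R : realType}.
Notation mu := (@lebesgue_measure R).

(** Markov's inequality bounds the measure of the set where [h n >= 1] by [e n], and Borel-Cantelli
    makes the limsup of these sets null. *)
Lemma ae_itv01_eventually_lt1 (h : nat -> R -> R) (e : nat -> R) :
  (forall n, continuous (h n)) -> (forall n x, 0 <= h n x) ->
  (forall n, (\int[mu]_(x in `[0%R, 1%R]) (h n x)%:E <= (e n)%:E)%E) ->
  (\sum_(0 <= n <oo) (e n)%:E < +oo)%E ->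
  {ae mu, forall x, `[0, 1] x -> \forall n \near \oo, h n x < 1}.
Proof.
move=> ch h0 he eoo.
pose F n : set (measurableTypeR R) :=
  `[0, 1] `&` [set x | (1%:E <= `|(h n x)%:E|)%E].
have mh n : measurable_fun (`[0, 1] : set (measurableTypeR R))
    (fun x : measurableTypeR R => (h n x)%:E).
  by apply/measurable_EFinP/measurable_funTS; exact: continuous_measurable_fun.
have mF n : measurable (F n).
  apply: emeasurable_fun_c_infty => //; exact: measurableT_comp.
have muF n : (mu (F n) <= (e n)%:E)%E.
  have := @le_integral_abse _ _ _ mu `[0, 1] _ (fun x => (h n x)%:E) 1 (mh n) ltr01.
  rewrite mul1e => /(_ (measurable_itv _)); move=> /le_trans; apply.
  apply: le_trans (he n); rewrite le_eqVlt; apply/orP; left; apply/eqP.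
  by apply: eq_integral => x _; rewrite /= ger0_norm.
have F0 : mu (lim_sup_set F) = 0%E.
  apply: lim_sup_set_cvg0 => //; apply: le_lt_trans eoo.
  by apply: lee_nneseries => n *; [exact: measure_ge0|exact: muF].
have mlF : measurable (lim_sup_set F).
  by apply: bigcap_measurable => // k _; exact: bigcup_measurable.
apply: negligibleS (proj2 (negligibleP mu mlF) F0) => x /= /not_implyP[x01 nx].
move=> k _ /=; apply: contrapT => nF; apply: nx.
exists k => // n /= kn; rewrite ltNge; apply/negP => hn; apply: nF.
by exists n => //; split => //=; rewrite lee_fin ger0_norm.
Qed.

Lemma integral_expR_range_iter_fold (c : nat -> R) (l : R) (N M : nat) :
  (\int[mu]_(x in `[0%R, 1%R])
     (expR (l * \sum_(N <= i < M) c i * (iter i fold x - 2^-1)))%:E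
   <= (expR (2^-1 * (l ^+ 2 * \sum_(N <= i < M) c i ^+ 2)))%:E)%E.
Proof.
(* Padding with zero coefficients below [N] reduces to sums that start at 0. *)
pose a i := if (N <= i)%N then l * c i else 0.
have sumE (y : nat -> R) : l * \sum_(N <= i < M) c i * y i = \sum_(0 <= i < M) a i * y i.
  rewrite mulr_sumr (@big_nat_widenl _ _ _ N 0)//= big_mkcond/=.
  by apply: eq_bigr => i _; rewrite /a; case: ifP => _; rewrite ?mul0r// mulrA.
have -> : l ^+ 2 * \sum_(N <= i < M) c i ^+ 2 = \sum_(0 <= i < M) a i ^+ 2.
  rewrite mulr_sumr (@big_nat_widenl _ _ _ N 0)//= big_mkcond/=.
  by apply: eq_bigr => i _; rewrite /a; case: ifP => _; rewrite ?exprMn// expr0n.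
by under eq_integral do rewrite sumE; exact: integral_expR_iter_fold.
Qed.

End almost_everywhere_bounds.

(** * Deviations of the centered tails of the tent series *)

Section tent_tails.
Context {R : realType}.
Notation mu := (@lebesgue_measure R).
Variable c : nat -> R.
Hypothesis cc : cvgn [normed series c].

Let s N := tailsum c N.
Let v N := tailsum (fun n => c n ^+ 2) N.
Let D N x := tailsum (fun n => c n * (iter n fold x - 2^-1)) N.

Let centered_le n (x : R) : `[0, 1] x ->
  `|c n * (iter n fold x - 2^-1)| <= `|c n|.
Proof.
move=> x01; rewrite normrM ler_piMr// ler_norml.
by move: (iter_fold_itv n x01); rewrite /= in_itv/= => /andP[? ?]; lra.
Qed.

Let cvgn_centered x : `[0, 1] x ->
  cvgn (series (fun n => c n * (iter n fold x - 2^-1))).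
Proof. by move=> x01; apply: (dominated_cvgn_series cc) => n; exact: centered_le. Qed.

(** Centering each iterate at 1/2 splits off half of [s N]. Since [tent_f] starts at index 1,
    cutting it at [N] requires [N] positive. *)
Lemma tent_f_subE N x : (0 < N)%N -> `[0, 1] x ->
  tent_f c x - tent_fN c N x = D N x + 2^-1 * s N.
Proof.
move=> N0 x01; have ck := normed_cvg cc.
have wE : (fun n => c n * tent_iter n x) =
    (fun n => c n * (iter n fold x - 2^-1) + 2^-1 * c n).
  by apply/funext => n; rewrite tent_iter_fold//; lra.
have cw : cvgn (series (fun n => c n * tent_iter n x)).
  apply: (dominated_cvgn_series cc) => n.
  rewrite tent_iter_fold// normrM ler_piMr// ler_norml.
  by move: (iter_fold_itv n x01); rewrite /= in_itv/= => /andP[? ?]; lra.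
rewrite /tent_f /tent_fN (tailsum_split N0 cw) addrAC subrr add0r wE.
by rewrite tailsum_lin//; exact: cvgn_centered.
Qed.

(** The remainder is dominated by a tail of the series of [|c n|], which does not depend on [x]. *)
Lemma exists_uniform_truncation N (d : R) : 0 < d -> exists M, forall x, `[0, 1] x ->
  `|D N x - \sum_(N <= i < M) c i * (iter i fold x - 2^-1)| <= d.
Proof.
move=> d0; have := cvgr_dist_lt _ _ (tailsum_cvg0 cc) _ d0.
move=> [M0 _ HM]; exists (maxn N M0) => x x01.
rewrite /D (tailsum_split (leq_maxl N M0) (cvgn_centered x01)) addrAC subrr add0r.
apply: (le_trans (ler_norm_tailsum _ cc _)); first by move=> n; exact: centered_le.
have := HM _ (leq_maxr N M0); rewrite /= sub0r normrN => /ltW; apply: le_trans.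
exact: ler_norm.
Qed.

Hypothesis v0 : forall N, (1 <= N)%N -> 0 < v N.
Hypothesis s0 : forall N, (1 <= N)%N -> s N != 0.
Hypothesis summ : forall K : R, 0 < K ->
  (\sum_(1 <= N <oo) (expR (- K * (s N ^+ 2 / v N)))%:E < +oo)%E.

(** One [k * |s|] pays for truncating the tail, the other for the deviation of the finite sum. The
    index [N.+1] stays where [v0] and [s0] apply. *)
Lemma ae_tail_le (k : R) : 0 < k -> {ae mu, forall x, `[0, 1] x ->
  \forall N \near \oo, `|D N.+1 x| <= 2 * k * `|s N.+1|}.
Proof.
move=> k0.
(* Each infinite tail is replaced by a finite one, uniformly in [x], so that the
   exponential moments of finite sums suffice. *)
have [M HM] : {M : nat -> nat & forall N x, `[0, 1] x -> `|D N.+1 x -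
    \sum_(N.+1 <= i < M N) c i * (iter i fold x - 2^-1)| <= k * `|s N.+1|}.
  apply: (@choice _ _ (fun N M => forall x, `[0, 1] x -> `|D N.+1 x -
    \sum_(N.+1 <= i < M) c i * (iter i fold x - 2^-1)| <= k * `|s N.+1|)) => N.
  by apply: exists_uniform_truncation; rewrite mulr_gt0// normr_gt0 s0.
(* [exp(l P)] has mean at most [exp(l^2 v / 2)] and [l P >= r] when
   [|P| >= k |s|]; [l = k s / v] optimizes the resulting exponential bound. *)
pose P N x := \sum_(N.+1 <= i < M N) c i * (iter i fold x - 2^-1).
pose l N := k * s N.+1 / v N.+1.
pose r N := k ^+ 2 * (s N.+1 ^+ 2 / v N.+1).
(* Adding the exponential bounds for both signs makes [h N x < 1] control [|P N x|]. *)
pose h N x :=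
  expR (- r N) * expR (l N * P N x) + expR (- r N) * expR (- l N * P N x).
have cP N : continuous (P N).
  rewrite /P; elim: (M N) => [|m IHm].
    by under eq_fun do rewrite big_geq//; exact: cst_continuous.
  have [Nm|mN] := leqP N.+1 m; last first.
    by under eq_fun do rewrite big_geq//; exact: cst_continuous.
  under eq_fun do rewrite big_nat_recr//=.
  move=> x; apply: cvgD; first exact: IHm.
  apply: cvgM; first exact: cvg_cst.
  by apply: cvgB; [exact: continuous_iter_fold|exact: cvg_cst].
have ceP N (p q : R) : continuous (fun x => p * expR (q * P N x)).
  move=> x; apply: cvgM; first exact: cvg_cst.
  apply: (continuous_cvg _ (@continuous_expR R _)).
  by apply: cvgM; [exact: cvg_cst|exact: cP].
have mE N (p q : R) : measurable_fun (`[0, 1] : set (measurableTypeR R))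
    (fun x : measurableTypeR R => (p * expR (q * P N x))%:E).
  apply/measurable_EFinP; apply: measurable_funTS.
  exact: (continuous_measurable_fun (ceP N p q)).
(* This form serves [q = l] and [q = - l] alike. As [l^2 v = r], the total exponent is
   [- r + r / 2 = - r / 2]. *)
have half N q : q ^+ 2 = l N ^+ 2 ->
    (\int[mu]_(x in `[0%R, 1%R]) (expR (- r N) * expR (q * P N x))%:E <=
     (expR (- (k ^+ 2 / 2) * (s N.+1 ^+ 2 / v N.+1)))%:E)%E.
  move=> ql; under eq_integral do rewrite EFinM.
  rewrite ge0_integralZl_EFin ?expR_ge0//; last first.
    by apply: eq_measurable_fun (mE N 1 q) => x _; rewrite mul1r.
  apply: (@le_trans _ _ ((expR (- r N))%:E * (expR (2^-1 * (q ^+ 2 * v N.+1)))%:E)%E).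
    apply: lee_wpmul2l; first by rewrite lee_fin expR_ge0.
    apply: le_trans (integral_expR_range_iter_fold _ _ _ _) _.
    rewrite lee_fin ler_expR ler_wpM2l// ler_wpM2l ?sqr_ge0//.
    by apply: sum_le_tailsum; [exact: cvgn_series_sqr|move=> n; exact: sqr_ge0].
  rewrite -EFinM -expRD lee_fin ler_expR le_eqVlt; apply/orP; left; apply/eqP.
  by rewrite ql /l /r; field; rewrite gt_eqF// v0.
have aeh : {ae mu, forall x, `[0, 1] x -> \forall N \near \oo, h N x < 1}.
  apply: (@ae_itv01_eventually_lt1 R h
    (fun N => 2 * expR (- (k ^+ 2 / 2) * (s N.+1 ^+ 2 / v N.+1)))) => [N x|N x|N|].
  - by apply: cvgD; exact: ceP.
  - by rewrite addr_ge0// mulr_ge0// expR_ge0.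
  - under eq_integral do rewrite EFinD.
    rewrite ge0_integralD//=.
    by rewrite mulrDl mul1r EFinD; apply: leeD; apply: half; rewrite ?sqrrN.
  - under eq_eseriesr do rewrite EFinM.
    rewrite nneseriesZl; last by move=> n _; rewrite lee_fin expR_ge0.
    rewrite lte_mul_pinfty//.
    have K0 : 0 < k ^+ 2 / 2 by rewrite divr_gt0// exprn_gt0.
    have := summ K0; rewrite -(nneseries_addn 1); last first.
      by move=> n; rewrite lee_fin expR_ge0.
    by under eq_eseriesr do rewrite addn1.
move: aeh; apply: (@filterS _ _ (ae_filter_ringOfSetsType mu)) => x + x01.
move=> /(_ x01); apply: filterS => N hN.
have vN : 0 < v N.+1 by exact: v0.
have sN : s N.+1 != 0 by exact: s0.
have ePr q : expR (- r N) * expR (q * P N x) < 1 -> q * P N x < r N.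
  by rewrite -expRD -[ltRHS]expR0 ltr_expR; lra.
have h1 : l N * P N x < r N.
  by apply: ePr; apply: le_lt_trans hN; rewrite lerDl mulr_ge0// expR_ge0.
have h2 : - l N * P N x < r N.
  by apply: ePr; apply: le_lt_trans hN; rewrite lerDr mulr_ge0// expR_ge0.
have PN : `|P N x| <= k * `|s N.+1|.
  have : `|l N * P N x| < r N by rewrite ltr_norml; apply/andP; split; lra.
  rewrite /l /r -(real_normK (num_real (s N.+1))) !normrM normfV.
  rewrite (gtr0_norm k0) (gtr0_norm vN).
  have -> : k ^+ 2 * (`|s N.+1| ^+ 2 / v N.+1) =
      (k * `|s N.+1| / v N.+1) * (k * `|s N.+1|) by ring.
  by rewrite ltr_pM2l ?divr_gt0 ?mulr_gt0 ?normr_gt0// => /ltW.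
rewrite -(subrK (P N x) (D N.+1 x)) (le_trans (ler_normD _ _))//.
by have := HM N x x01; rewrite -/(P N x); lra.
Qed.

End tent_tails.

(** * The almost everywhere limit of the quotient *)

Theorem theorem1p1 (R : realType) (c : nat -> R) :
  (\sum_(1 <= n <oo) (`|c n|)%:E < +oo)%E ->
  (forall N : nat, (1 <= N)%N -> 0 < tailsum (fun n => c n ^+ 2) N) ->
  (forall N : nat, (1 <= N)%N -> tailsum c N != 0) ->
  (forall K : R, 0 < K ->
     (\sum_(1 <= N <oo)
        (expR (- K * (tailsum c N ^+ 2 / tailsum (fun n => c n ^+ 2) N)))%:E
        < +oo)%E) ->
  {ae (@lebesgue_measure R), forall x : R, `[0, 1] x ->
     (fun N : nat => (tent_f c x - tent_fN c N x) / (2^-1 * tailsum c N))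
       @ \oo --> (1 : R)}.
Proof.
move=> /cvgn_normed_series cc v0 s0 summ.
(* Taking [k = 1 / (j + 1)] lets [k] tend to 0 while the union of the exceptional sets stays
   null. *)
have := ae_foralln (fun j =>
  ae_tail_le cc v0 s0 summ (k := j.+1%:R^-1) ltac:(by rewrite invr_gt0)).
apply: filterS => x aex x01.
rewrite -cvg_shiftS; apply/cvgrPdist_le => e e0.
(* The factor 4 is the 2 in the bound [2 * k * |s|] times the 2 from dividing by [s / 2]. *)
have [j je] : exists j : nat, 4 * j.+1%:R^-1 <= e.
  have e4 : 0 < e / 4 by rewrite divr_gt0.
  have [j jlt] := ltr_add_invr e4; exists j.
  by rewrite mulrC -ler_pdivlMr// -[leLHS]add0r ltW.
apply: filterS (aex j x01) => N /= DN.
have sN : 0 < `|tailsum c N.+1| by rewrite normr_gt0 s0.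
rewrite tent_f_subE//; set d := tailsum _ _ in DN *; set s := tailsum c _ in sN DN *.
have s_neq0 : s != 0 by rewrite -normr_gt0.
have -> : 1 - (d + 2^-1 * s) / (2^-1 * s) = - (2 * d / s) by field.
rewrite normrN normrM normfV ler_pdivrMr// normrM (ger0_norm (ler0n R 2)).
have := ler_wpM2l (ler0n R 2) DN; rewrite !mulrA -natrM.
by move=> /le_trans; apply; rewrite ler_wpM2r.
Qed.
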